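(* Let $G$ be a finite simple undirected graph, let $\vec H$ be a digraph, and let $H$ be the undirected graph underlying $\vec H$. Let $D(G,\vec H)$ be the number of orientations of $G$ that do not contain a copy of $\vec H$, and $D'(G,H)$ the number of subgraphs of $G$ that do not contain a copy of $H$. Then $D(G,\vec H)\le D'(G,H)$.
   Context: A subgraph of $G=(V,E)$ means a spanning subgraph $(V,X)$ with $X\subseteq E$. An orientation of $G$ assigns a direction to each edge. A digraph contains a copy of $\vec H$ if it has a subdigraph isomorphic to $\vec H$; a graph contains a copy of $H$ if it has a subgraph isomorphic to $H$. *)

(* Defs.v *)
From mathcomp Require Import all_boot.

Set Implicit Arguments.
Unset Strict Implicit.
Unset Printing Implicit Defensive.

(* Digraphs and graphs are taken in full generality: loops, parallel arcs/edges
   and opposite arcs are allowed. An undirected edge has a set of one (for a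
   loop) or two ends. *)
Record digraph := Digraph {
  dvert : finType;
  darc : finType;
  dtail : darc -> dvert;
  dhead : darc -> dvert }.

Record graph := Graph {
  gvert : finType;
  gedge : finType;
  gends : gedge -> {set gvert};
  gendsP : forall e, 0 < #|gends e| <= 2 }.

Lemma card_ends (T : finType) (x y : T) : 0 < #|[set x; y]| <= 2.
Proof. by rewrite cards2; case: (x != y). Qed.

(* Every arc becomes its own edge, so a pair of opposite arcs becomes a pair of
   parallel edges. *)
Definition underlying (D : digraph) : graph :=
  @Graph (dvert D) (darc D) (fun a => [set dtail a; dhead a])
    (fun a => card_ends (dtail a) (dhead a)).

Definition is_subdigraph (D : digraph) (U : {set dvert D})
    (B : {set darc D}) : bool :=
  [forall b in B, (dtail b \in U) && (dhead b \in U)].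

(* (f, g) is an isomorphism from K onto the subdigraph (U, B) of D. *)
Definition is_disom (K D : digraph) (U : {set dvert D}) (B : {set darc D})
    (f : {ffun dvert K -> dvert D}) (g : {ffun darc K -> darc D}) : bool :=
  [&& injectiveb f, injectiveb g, f @: setT == U, g @: setT == B &
      [forall a, (dtail (g a) == f (dtail a)) && (dhead (g a) == f (dhead a))]].

Definition dcontains (D K : digraph) : bool :=
  [exists U : {set dvert D}, exists B : {set darc D},
     is_subdigraph U B &&
     [exists f : {ffun dvert K -> dvert D},
        exists g : {ffun darc K -> darc D}, is_disom U B f g]].

(* Here the vertex set U of a subgraph is arbitrary: a copy of a smaller graph
   need not span the host. *)
Definition is_subgraph (F : graph) (U : {set gvert F})
    (B : {set gedge F}) : bool :=
  [forall b in B, gends b \subset U].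

Definition is_gisom (K F : graph) (U : {set gvert F}) (B : {set gedge F})
    (f : {ffun gvert K -> gvert F}) (g : {ffun gedge K -> gedge F}) : bool :=
  [&& injectiveb f, injectiveb g, f @: setT == U, g @: setT == B &
      [forall e, gends (g e) == f @: gends e]].

Definition gcontains (F K : graph) : bool :=
  [exists U : {set gvert F}, exists B : {set gedge F},
     is_subgraph U B &&
     [exists f : {ffun gvert K -> gvert F},
        exists g : {ffun gedge K -> gedge F}, is_gisom U B f g]].

Record sgraph := SGraph {
  svert : finType;
  sedges : {set {set svert}};
  sedgesP : forall e, e \in sedges -> #|e| = 2 }.

Definition is_orientation (G : sgraph) (O : {set svert G * svert G}) : bool :=
  [forall a in O, [set a.1; a.2] \in sedges G] &&
  [forall e in sedges G, #|[set a in O | [set a.1; a.2] == e]| == 1].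

Definition orientation (G : sgraph) :=
  {O : {set svert G * svert G} | is_orientation O}.

Definition oriented (G : sgraph) (O : orientation G) : digraph :=
  @Digraph (svert G) {a : svert G * svert G | a \in val O}
    (fun a => (val a).1) (fun a => (val a).2).

Definition spanning_subgraph (G : sgraph) :=
  {X : {set {set svert G}} | X \subset sedges G}.

Lemma spanning_ends (G : sgraph) (X : spanning_subgraph G)
    (e : {e : {set svert G} | e \in val X}) : 0 < #|val e| <= 2.
Proof. by rewrite (sedgesP (subsetP (valP X) _ (valP e))). Qed.

Definition spanned (G : sgraph) (X : spanning_subgraph G) : graph :=
  @Graph (svert G) {e : {set svert G} | e \in val X} (fun e => val e)
    (@spanning_ends G X).

Definition num_free_orientations (G : sgraph) (K : digraph) : nat :=
  #|[set O : orientation G | ~~ dcontains (oriented O) K]|.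

Definition num_free_subgraphs (G : sgraph) (K : graph) : nat :=
  #|[set X : spanning_subgraph G | ~~ gcontains (spanned X) K]|.

(* Main.v *)
(** Fix an ordering of the vertices of [G] and encode an orientation of [G] by
    the set of edges that it directs upwards.  By Pajor's inequality, the
    family of codes of the orientations avoiding the digraph shatters at least
    as many sets of edges as it has members.  A shattered set of edges contains
    no copy of the underlying graph: shattering lets us choose an orientation
    in the family that directs the edges of such a copy as in the digraph. *)
Require Import Defs.
From mathcomp Require Import all_boot.

Set Implicit Arguments.
Unset Strict Implicit.
Unset Printing Implicit Defensive.

(** * Shattering and Pajor's inequality *)

Section Pajor.

Variable T : finType.
Implicit Types (F : {set {set T}}) (Y Z A E : {set T}).

Definition shatters F Y : bool :=
  [forall Z : {set T}, (Z \subset Y) ==> [exists A in F, A :&: Y == Z]].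

Definition shattered F : {set {set T}} := [set Y | shatters F Y].

Lemma shattersP F Y :
  reflect (forall Z, Z \subset Y -> exists2 A, A \in F & A :&: Y = Z)
          (shatters F Y).
Proof.
apply: (iffP forallP) => h Z.
  by move=> sZY; have /implyP/(_ sZY)/exists_inP[A AF /eqP eA] := h Z; exists A.
by apply/implyP => /h[A AF eA]; apply/exists_inP; exists A => //; apply/eqP.
Qed.

Lemma shatters_mono F F' Y : F \subset F' -> shatters F Y -> shatters F' Y.
Proof.
move=> /subsetP sFF' /shattersP h; apply/shattersP => Z /h[A /sFF' AF' eA].
by exists A.
Qed.

Lemma shatters_sub F Y E :
  (forall A, A \in F -> A \subset E) -> shatters F Y -> Y \subset E.
Proof.
move=> sFE /shattersP/(_ Y (subxx _))[A /sFE sAE <-].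
exact: subset_trans (subsetIl _ _) sAE.
Qed.

Lemma shatters0 F A : A \in F -> shatters F set0.
Proof.
move=> AF; apply/shattersP => Z; rewrite subset0 => /eqP->.
by exists A => //; rewrite setI0.
Qed.

(** The traces [Y] and [set0] on a set [Y] containing [x] need members of [F] that disagree at
    [x]. *)
Lemma shatters_in F Y x b :
  (forall A, A \in F -> (x \in A) = b) -> shatters F Y -> x \notin Y.
Proof.
move=> hF /shattersP h; apply/negP => xY.
have [A AF eA] := h Y (subxx _).
have [B BF eB] := h set0 (sub0set _).
have := in_setI x A Y; rewrite eA xY hF // andbT.
by have := in_setI x B Y; rewrite eB in_set0 xY hF // andbT => <-.
Qed.

(** A trace [Z] on [x |: Y] comes from the trace [Z :\ x] on [Y], realized in the half of [F] that
    treats [x] as [Z] does. *)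
Lemma shatters_setU1 F Y x :
    shatters [set A in F | x \in A] Y -> shatters [set A in F | x \notin A] Y ->
  shatters F (x |: Y).
Proof.
move=> h1 h0; apply/shattersP => Z sZ.
have sZY : Z :\ x \subset Y by rewrite subDset.
have [xZ|xZ] := boolP (x \in Z).
  have /shattersP/(_ _ sZY)[A] := h1; rewrite inE => /andP[AF xA] eA.
  exists A => //; rewrite setIUr eA; apply/setP => z; rewrite !inE.
  by case: eqP => [->|] //=; rewrite ?xA ?xZ // andbF.
have /shattersP/(_ _ sZY)[A] := h0; rewrite inE => /andP[AF xA] eA.
exists A => //; rewrite setIUr eA; apply/setP => z; rewrite !inE.
by case: eqP => [->|] //=; rewrite ?(negPf xA) ?(negPf xZ) // andbF.
Qed.

(** Induction on the size of [F], splitting it at an element [x] into two halves. No set shattered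
    by a half contains [x]; a set [Y] shattered by both halves is counted twice, and the second
    count is charged to [x |: Y], which [F] shatters too. *)
Lemma pajor F : #|F| <= #|shattered F|.
Proof.
have [n] := ubnP #|F|; elim: n F => // n IHn F; rewrite ltnS => leFn.
have [F1|] := leqP #|F| 1.
  have [->|[A AF]] := set_0Vmem F; first by rewrite cards0.
  apply: leq_trans F1 _; apply/card_gt0P.
  by exists set0; rewrite inE (shatters0 AF).
case/card_gt1P=> A [B [AF BF neqAB]].
(* Splitting at a point where two members differ leaves both halves nonempty, hence both strictly
   smaller than [F]. *)
have [x neqx] : exists x, (x \in A) != (x \in B).
  apply/existsP; apply: contraNT neqAB => /existsPn h.
  by apply/eqP/setP => x; apply/eqP; rewrite -[_ == _]negbK h.
pose F1 := [set A in F | x \in A]; pose F0 := [set A in F | x \notin A].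
have cardF : #|F1| + #|F0| = #|F|.
  rewrite -(cardsID [set A : {set T} | x \in A] F); congr (_ + _).
    by apply: eq_card => C; rewrite !inE.
  by apply: eq_card => C; rewrite !inE andbC.
have F1_gt0 : 0 < #|F1|.
  apply/card_gt0P; case xA: (x \in A) neqx => xB.
    by exists A; rewrite inE AF.
  by exists B; rewrite inE BF; case: (x \in B) xB.
have F0_gt0 : 0 < #|F0|.
  apply/card_gt0P; case xA: (x \in A) neqx => xB.
    by exists B; rewrite inE BF; case: (x \in B) xB.
  by exists A; rewrite inE AF xA.
have le1 : #|F1| <= #|shattered F1|.
  by apply: IHn; apply: leq_trans leFn; rewrite -cardF -addn1 leq_add2l.
have le0 : #|F0| <= #|shattered F0|.
  by apply: IHn; apply: leq_trans leFn; rewrite -cardF -add1n leq_add2r.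
have notin1 Y : Y \in shattered F1 -> x \notin Y.
  by rewrite inE; apply: (@shatters_in _ _ _ true) => C; rewrite inE => /andP[].
have notin0 Y : Y \in shattered F0 -> x \notin Y.
  rewrite inE; apply: (@shatters_in _ _ _ false) => C; rewrite inE => /andP[_].
  by move/negPf.
rewrite -cardF; apply: leq_trans (leq_add le1 le0) _.
rewrite -cardsUI.
set S := _ :&: _.
(* Adding [x] is injective on [S], since no set in [S] contains [x]. *)
have -> : #|S| = #|[set x |: Y | Y in S]|.
  rewrite card_in_imset // => Y Y'.
  rewrite !inE => /andP[hY _] /andP[hY' _] e.
  have xY := notin1 Y; have xY' := notin1 Y'; rewrite !inE in xY xY'.
  by rewrite -(setU1K (xY hY)) e setU1K ?xY'.
set U := _ :|: _.
have disj : U :&: [set x |: Y | Y in S] = set0.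
  apply/setP => Y; rewrite in_set0; apply/negP.
  rewrite inE => /andP[hU /imsetP[Y' _ eY]].
  have xY : x \in Y by rewrite eY setU11.
  by move: hU; rewrite in_setU => /orP[/notin1|/notin0]; rewrite xY.
rewrite -cardsUI disj cards0 addn0; apply/subset_leq_card/subsetP => Y.
rewrite in_setU => /orP[|/imsetP[Y' /setIP[]]].
  rewrite !inE => /orP[]; apply: shatters_mono; apply/subsetP => C;
    by rewrite inE => /andP[].
by rewrite !inE => h1 h0 ->; apply: shatters_setU1.
Qed.

End Pajor.

Lemma eq_set2P (T : finType) (x y u v : T) :
  [set x; y] = [set u; v] -> x = u /\ y = v \/ x = v /\ y = u.
Proof.
move=> /setP e.
have := e x; have := e y; have := e u; have := e v; rewrite !inE !eqxx !orbT /=.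
move=> /orP[]/eqP ev /orP[]/eqP eu /esym/orP[]/eqP ey /esym/orP[]/eqP ex;
  by subst; auto.
Qed.

(** * Coding orientations by their upward edges *)

Section Upward.

Variable G : sgraph.
Implicit Types (O : orientation G) (x y : svert G).

Lemma sedge_neq x y : [set x; y] \in sedges G -> x != y.
Proof. by move/sedgesP; rewrite cards2; case: (x != y). Qed.

Lemma orientation_edge O x y : (x, y) \in val O -> [set x; y] \in sedges G.
Proof. by case: O => O /= /andP[/forall_inP h _] /h. Qed.

Lemma orientation_sym O x y :
  [set x; y] \in sedges G -> ((x, y) \in val O) = ((y, x) \notin val O).
Proof.
move=> exy; have nxy := sedge_neq exy.
case: O => O /= /andP[_ /forall_inP/(_ _ exy)/cards1P[[u v] /setP e]].
have := e (u, v); rewrite !inE eqxx /= => /andP[uvO /eqP/eq_set2P euv].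
have := e (x, y); have := e (y, x).
rewrite !inE /= [[set y; x]]setUC !eqxx !andbT => -> ->.
case: euv => -[-> ->]; rewrite !xpair_eqE !eqxx /=.
  by rewrite (negPf nxy) andbF.
by rewrite (negPf nxy).
Qed.

Definition upward O : {set {set svert G}} :=
  [set [set a.1; a.2] | a in val O & enum_rank a.1 < enum_rank a.2].

Lemma upward_sub O : upward O \subset sedges G.
Proof.
by apply/subsetP => e /imsetP[[x y]]; rewrite inE => /andP[/orientation_edge ? _] ->.
Qed.

Lemma mem_upward O x y : enum_rank x < enum_rank y ->
  ([set x; y] \in upward O) = ((x, y) \in val O).
Proof.
move=> ltxy; apply/imsetP/idP => [[[u v]]|xyO]; last first.
  by exists (x, y); rewrite // inE xyO.
rewrite inE /= => /andP[uvO ltuv] /eq_set2P[] [ex ey]; first by rewrite ex ey.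
by move: ltxy; rewrite ex ey ltnNge ltnW.
Qed.

(** Decodes [upward]: an arc is present exactly when its edge's code bit agrees with the order of
    its ends. This yields injectivity of the code and recovers arcs from a prescribed trace. *)
Lemma mem_orientation O x y : [set x; y] \in sedges G ->
  ((x, y) \in val O) = (([set x; y] \in upward O) == (enum_rank x < enum_rank y)).
Proof.
move=> exy; case: ltngtP => [lt|lt|/ord_inj/enum_rank_inj eq_xy].
- by rewrite mem_upward // eqb_id.
- by rewrite eqbF_neg setUC mem_upward // orientation_sym.
- by have := sedge_neq exy; rewrite eq_xy eqxx.
Qed.

Lemma upward_inj : injective upward.
Proof.
move=> O O' e; apply/val_inj/setP => -[x y].
have [exy|nexy] := boolP ([set x; y] \in sedges G).
  by rewrite !mem_orientation // e.
by rewrite !(contraNF (@orientation_edge _ x y) nexy).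
Qed.

End Upward.

(** * From shattered edge sets to copies of the digraph *)

Lemma gcontainsP (F K : graph) :
  gcontains F K ->
  exists (f : gvert K -> gvert F) (g : gedge K -> gedge F),
    [/\ injective f, injective g & forall e, gends (g e) = f @: gends e].
Proof.
case/existsP=> U /existsP[B /andP[_ /existsP[f /existsP[g]]]].
case/and5P=> /injectiveP fi /injectiveP gi _ _ /forallP h.
by exists f, g; split=> // e; apply/eqP.
Qed.

Lemma dcontains_of_embedding (D K : digraph)
    (f : dvert K -> dvert D) (g : darc K -> darc D) :
    injective f -> injective g ->
    (forall a, dtail (g a) = f (dtail a)) ->
    (forall a, dhead (g a) = f (dhead a)) ->
  dcontains D K.
Proof.
move=> fi gi ht hh.
apply/existsP; exists ([ffun x => f x] @: setT).
apply/existsP; exists ([ffun x => g x] @: setT).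
apply/andP; split.
  apply/forall_inP => b /imsetP[a _ ->]; rewrite ffunE ht hh.
  by rewrite -![f _](ffunE f) !imset_f.
apply/existsP; exists [ffun x => f x]; apply/existsP; exists [ffun x => g x].
apply/and5P; split=> //.
- by apply/injectiveP => x y; rewrite !ffunE; apply: fi.
- by apply/injectiveP => x y; rewrite !ffunE; apply: gi.
- by apply/forallP => a; rewrite !ffunE ht hh !eqxx.
Qed.

Lemma shattered_free (G : sgraph) (K : digraph) (X : spanning_subgraph G) :
    shatters (@upward G @: [set O | ~~ dcontains (oriented O) K]) (val X) ->
  ~~ gcontains (spanned X) (underlying K).
Proof.
move=> /shattersP sh; apply/negP => /gcontainsP[/= f [g [fi gi hg]]].
have eg a : val (g a) = [set f (dtail a); f (dhead a)].
  by rewrite [LHS]hg imsetU1 imset_set1.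
have gX a : [set f (dtail a); f (dhead a)] \in val X by rewrite -eg (valP (g a)).
pose up a := enum_rank (f (dtail a)) < enum_rank (f (dhead a)).
(* The trace to realize: the edges of the copy that must point upward for [f] to preserve
   directions. Since [g] is injective, distinct arcs of [K] never make conflicting demands on one
   edge. *)
pose Z := [set val (g a) | a in [set a | up a]].
have memZ a : (val (g a) \in Z) = up a.
  apply/imsetP/idP => [[b]|upa]; last by exists a; rewrite // inE.
  by rewrite inE => upb /val_inj/gi->.
have /sh[_ /imsetP[O free ->] eZ] : Z \subset val X.
  by apply/subsetP => _ /imsetP[a _ ->]; apply: valP.
have inO a : (f (dtail a), f (dhead a)) \in val O.
  rewrite mem_orientation ?(subsetP (valP X)) //; apply/eqP.
  by have := memZ a; rewrite -eZ inE eg gX andbT.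
move: free; rewrite inE => /negP; apply.
apply: (@dcontains_of_embedding (oriented O) K f
          (fun a => Sub (f (dtail a), f (dhead a)) (inO a))) => // a b.
(* Equal image arcs have the same underlying edge, so injectivity of [g] carries over to the arc
   map. *)
move=> /(congr1 val) /= [et eh].
by apply: gi; apply: val_inj; rewrite !eg et eh.
Qed.

Theorem theorem3p14 (G : sgraph) (Hvec : digraph) :
  num_free_orientations G Hvec <= num_free_subgraphs G (underlying Hvec).
Proof.
rewrite /num_free_orientations -(card_imset _ (@upward_inj G)).
apply: leq_trans (pajor _) _; set F := imset _ _.
rewrite /num_free_subgraphs -[leqRHS](card_imset _ val_inj).
apply/subset_leq_card/subsetP => Y; rewrite inE => shY.
(* A shattered set is itself a trace of some code, so it consists of edges of [G] and defines a
   spanning subgraph. *)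
have sYE : Y \subset sedges G.
  by apply: shatters_sub shY => _ /imsetP[O _ ->]; apply: upward_sub.
apply/imsetP; exists (Sub Y sYE : spanning_subgraph G); last by rewrite SubK.
by rewrite inE; apply: shattered_free; rewrite SubK.
Qed.
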